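(* Let $H$ be a finite or infinite dimensional complex Hilbert space. The ideal $F(H)$ of finite rank operators, regarded as a multiplicative semigroup, is an SI semigroup, and all other nonzero proper two-sided ideals of the ring $B(H)$, regarded as multiplicative semigroups, are not SI semigroups.
   Context: $B(H)$ is the ring of bounded linear operators on $H$, and $F(H)$ is its subset of finite rank operators. A semigroup $\mathcal S\subset B(H)$ is a subset closed under multiplication. A semigroup-ideal $J$ of a semigroup $\mathcal S$ is a subset $J\subset\mathcal S$ with $XA, AX\in J$ for all $A\in J$, $X\in\mathcal S$ (no closure under sums or scalars is required). $\mathcal S$ is a selfadjoint-ideal (SI) semigroup if every semigroup-ideal $J$ of $\mathcal S$ satisfies $\{A^*: A\in J\}\subset J$.
   Formalization: The claim that all other nonzero proper ideals are not SI is proved for separable H only; it fails for every nonseparable H, where the ideal of operators with separable range is SI. That F(H) is SI is proved for every H. *)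

(* Defs.v *)
From HB Require Import structures.
From mathcomp Require Import all_boot all_order all_algebra.
From mathcomp Require Import complex.
From mathcomp Require Import all_classical all_reals all_analysis.

Set Implicit Arguments.
Unset Strict Implicit.
Unset Printing Implicit Defensive.

Import Order.TTheory GRing.Theory Num.Theory.

Local Open Scope classical_set_scope.
Local Open Scope ring_scope.

Section BoundedOperators.
Variables (K : numFieldType) (H : normedModType K).

Record bounded_op := BoundedOp {
  bop_fun :> H -> H ;
  bop_linear : linear bop_fun ;
  bop_bounded : exists M : K, forall x, `|bop_fun x| <= M * `|x| }.

HB.instance Definition _ (A : bounded_op) :=
  GRing.isLinear.Build K H H *:%R (bop_fun A) (@bop_linear A).

Lemma bopP (A B : bounded_op) : bop_fun A =1 bop_fun B -> A = B.
Proof.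
case: A => f fl fb; case: B => g gl gb /= /funext efg; subst g.
by congr BoundedOp; exact: Prop_irrelevance.
Qed.

HB.instance Definition _ := gen_eqMixin bounded_op.
HB.instance Definition _ := gen_choiceMixin bounded_op.

(* The bound can always be enlarged to a nonnegative one. *)
Lemma bop_bounded_ge0 (A : bounded_op) :
  exists2 M : K, 0 <= M & forall x, `|A x| <= M * `|x|.
Proof.
have [M AM] := bop_bounded A; exists `|M| => // x.
by rewrite (le_trans (AM x))// -[`|x| in leRHS]normr_id -normrM
  real_ler_norm// -(ler_real (AM x)) normr_real.
Qed.

Fact bop0_linear : linear (fun _ : H => 0 : H).
Proof. by move=> a x y; rewrite scaler0 addr0. Qed.

Fact bop0_bounded : exists M : K, forall x : H, `|0 : H| <= M * `|x|.
Proof. by exists 0 => x; rewrite normr0 mul0r. Qed.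

Definition bop0 := BoundedOp bop0_linear bop0_bounded.

Fact bop1_linear : linear (fun x : H => x).
Proof. by []. Qed.

Fact bop1_bounded : exists M : K, forall x : H, `|x| <= M * `|x|.
Proof. by exists 1 => x; rewrite mul1r. Qed.

Definition bop1 := BoundedOp bop1_linear bop1_bounded.

Fact bopN_linear (A : bounded_op) : linear (fun x => - A x).
Proof. by move=> a x y; rewrite linearP opprD scalerN. Qed.

Fact bopN_bounded (A : bounded_op) :
  exists M : K, forall x, `|- A x| <= M * `|x|.
Proof. by have [M AM] := bop_bounded A; exists M => x; rewrite normrN. Qed.

Definition bopN A := BoundedOp (bopN_linear A) (bopN_bounded A).

Fact bopD_linear (A B : bounded_op) : linear (fun x => A x + B x).
Proof. by move=> a x y; rewrite !linearP scalerDr addrACA. Qed.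

Fact bopD_bounded (A B : bounded_op) :
  exists M : K, forall x, `|A x + B x| <= M * `|x|.
Proof.
have [M AM] := bop_bounded A; have [N BN] := bop_bounded B.
exists (M + N) => x; rewrite mulrDl (le_trans (ler_normD _ _))//.
exact: lerD.
Qed.

Definition bopD A B := BoundedOp (bopD_linear A B) (bopD_bounded A B).

Fact bopM_linear (A B : bounded_op) : linear (fun x => A (B x)).
Proof. by move=> a x y; rewrite !linearP. Qed.

Fact bopM_bounded (A B : bounded_op) :
  exists M : K, forall x, `|A (B x)| <= M * `|x|.
Proof.
have [M M0 AM] := bop_bounded_ge0 A; have [N BN] := bop_bounded B.
exists (M * N) => x; rewrite (le_trans (AM _))// -mulrA.
exact: ler_wpM2l.
Qed.

Definition bopM A B := BoundedOp (bopM_linear A B) (bopM_bounded A B).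

Fact bopDA : associative bopD.
Proof. by move=> A B D; apply: bopP => x /=; rewrite addrA. Qed.

Fact bopDC : commutative bopD.
Proof. by move=> A B; apply: bopP => x /=; rewrite addrC. Qed.

Fact bop0D : left_id bop0 bopD.
Proof. by move=> A; apply: bopP => x /=; rewrite add0r. Qed.

Fact bopND : left_inverse bop0 bopN bopD.
Proof. by move=> A; apply: bopP => x /=; rewrite addNr. Qed.

HB.instance Definition _ :=
  GRing.isZmodule.Build bounded_op bopDA bopDC bop0D bopND.

Fact bopMA : associative bopM.
Proof. by move=> A B D; apply: bopP. Qed.

Fact bop1M : left_id bop1 bopM.
Proof. by move=> A; apply: bopP. Qed.

Fact bopM1 : right_id bop1 bopM.
Proof. by move=> A; apply: bopP. Qed.

Fact bopMDl : left_distributive bopM bopD.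
Proof. by move=> A B D; apply: bopP. Qed.

Fact bopMDr : right_distributive bopM bopD.
Proof. by move=> A B D; apply: bopP => x /=; rewrite linearD. Qed.

(* A possibly zero ring, since [H] may be the zero space. *)
HB.instance Definition _ := GRing.Zmodule_isPzRing.Build bounded_op
  bopMA bop1M bopM1 bopMDl bopMDr.

Definition finite_rank : set bounded_op := [set A : bounded_op |
  exists (n : nat) (e : 'I_n -> H), forall x, exists c : 'I_n -> K,
    A x = \sum_(i < n) c i *: e i].

End BoundedOperators.

Section Ideals.
Variable A : pzRingType.

Definition two_sided_ideal (I : set A) :=
  [/\ I 0,
      forall x y, I x -> I y -> I (x - y) &
      forall a x, I x -> I (a * x) /\ I (x * a)].

Definition semigroup (S : set A) := forall x y, S x -> S y -> S (x * y).

Definition semigroup_ideal (S J : set A) :=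
  J `<=` S /\ forall a x, J a -> S x -> J (x * a) /\ J (a * x).

End Ideals.

Section Adjoint.
Variables (R : realType) (H : completeNormedModType R[i]).
Variable dot : {dot H for Num.conj}.

(* When [dot] induces the (complete) norm of [H], the set below is a singleton
   by the Riesz representation theorem, so the default value is never used. *)
Definition adjoint (A : bounded_op H) : bounded_op H :=
  xget 0 [set B : bounded_op H | forall x y, dot (A x) y = dot x (B y)].

Definition SI_semigroup (S : set (bounded_op H)) :=
  semigroup S /\
  forall J : set (bounded_op H), semigroup_ideal S J -> adjoint @` J `<=` J.

End Adjoint.

Definition separable_space (T : topologicalType) :=
  exists D : set T, countable D /\ dense D.

(* Main.v *)
Require Import Defs.
From mathcomp Require Import all_boot all_order all_algebra.
From mathcomp Require Import complex.
From mathcomp Require Import all_classical all_reals all_analysis.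

Set Implicit Arguments.
Unset Strict Implicit.
Unset Printing Implicit Defensive.

Import Order.TTheory GRing.Theory Num.Theory.
Import numFieldNormedType.Exports.

Local Open Scope classical_set_scope.
Local Open Scope ring_scope.

(* A finite rank A has finitely many y_i such that the A y_i form an orthonormal
   basis of its range; with Y x = sum <x, A y_i> y_i the product A Y is the
   projection on that range, so A^* = A^* A Y lies in every semigroup-ideal of
   F(H) containing A.

   Let now I be any other nonzero proper ideal. By separability and properness,
   every X in I is arbitrarily small on subspaces of finite codimension, since
   otherwise X could be compressed to the identity. As F(H) is strictly
   contained in I, some A in I has infinite rank, and compressing A
   yields in I a positive diagonal operator T whose eigenvalues are constant on
   longer and longer blocks. A dimension count on such a block shows that
   T = X T Y is impossible when X or Y is in I. Hence the adjoint -iT of iT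
   is not in the semigroup-ideal of I generated by iT. *)

(** * Left kernels of tall matrices, and sequences chosen step by step *)

Lemma exists_left_kernel (F : fieldType) (N m : nat) (M : 'M[F]_(N, m)) :
  (m < N)%N -> exists2 c : 'rV[F]_N, c != 0 & c *m M = 0.
Proof.
move=> mN; have /rowV0Pn[c] : kermx M != 0.
  by rewrite kermx_eq0 /row_free neq_ltn (leq_ltn_trans (rank_leq_col M)).
by move=> /sub_kermxP cM c0; exists c.
Qed.

(** Each choice may depend on the whole list of earlier ones. This drives Gram-Schmidt and the
    greedy constructions in which either every list can be prolonged or a list that cannot carries
    the result. *)
Lemma seq_choice (T : Type) (P : seq T -> T -> Prop) :
  (forall s, exists t, P s t) -> exists f : nat -> T, forall n, P (mkseq f n) (f n).
Proof.
move=> /choice[g Pg]; pose S n := iter n (fun s => rcons s (g s)) [::].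
exists (g \o S) => n; suff -> : mkseq (g \o S) n = S n by exact: Pg.
by elim: n => //= n IH; rewrite mkseqS IH.
Qed.

(** * Inner product, orthogonal sums, Bessel and Cauchy-Schwarz inequalities *)

Section Hilbert.
Variables (R : realType) (H : completeNormedModType R[i]).
Variable dot : {dot H for Num.conj}.
Hypothesis dot_norm : forall x : H, `|x| ^+ 2 = dot x x.
Implicit Types (x y : H) (u v w : nat -> H).

Lemma dotZl (k : R[i]) x y : dot (k *: x) y = k * dot x y.
Proof. by rewrite linearZl_LR. Qed.

Lemma dotZr (k : R[i]) x y : dot x (k *: y) = k^* * dot x y.
Proof. by rewrite linearZr_LR. Qed.

Lemma dotC x y : dot x y = (dot y x)^*.
Proof. by rewrite hermC /= expr0 mul1r. Qed.

Lemma dot_suml I (r : seq I) (E : I -> H) y :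
  dot (\sum_(i <- r) E i) y = \sum_(i <- r) dot (E i) y.
Proof. by rewrite linear_sumlz. Qed.

Lemma dot_sumr I (r : seq I) (E : I -> H) x :
  dot x (\sum_(i <- r) E i) = \sum_(i <- r) dot x (E i).
Proof. by rewrite linear_sumr. Qed.

Lemma dot_eq0C x y : dot x y = 0 -> dot y x = 0.
Proof. by move=> xy0; rewrite dotC xy0 rmorph0. Qed.

Lemma dot_eqr x y : (forall z, dot z x = dot z y) -> x = y.
Proof.
move=> xy; apply/eqP; rewrite -subr_eq0 -(dnorm_eq0 dot).
by rewrite linearBr /= xy subrr.
Qed.

Lemma ler_norm_sqr (k : R[i]) x : 0 <= k -> (`|x| <= k) = (`|x| ^+ 2 <= k ^+ 2).
Proof. by move=> k0; rewrite ler_sqr ?nnegrE. Qed.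

(* Zero vectors are allowed, so that Gram-Schmidt may be run on a linearly
   dependent sequence. *)
Definition subON u :=
  (forall i j, i != j -> dot (u i) (u j) = 0) /\ (forall i, `|u i| <= 1).

Definition ON u := forall i j, dot (u i) (u j) = (i == j)%:R.

Lemma ON_subON u : ON u -> subON u.
Proof.
move=> uON; split=> [i j /negPf ij|i]; first by rewrite uON ij.
by rewrite ler_norm_sqr// dot_norm uON eqxx expr1n.
Qed.

Lemma dot_sum_orthogonal (I : eqType) (u : I -> H) (c : I -> R[i]) (r : seq I) i :
  (forall i j, i != j -> dot (u i) (u j) = 0) -> uniq r -> i \in r ->
  dot (\sum_(j <- r) c j *: u j) (u i) = c i * `|u i| ^+ 2.
Proof.
move=> uo ur ir; rewrite dot_suml (bigD1_seq i)//= big1 ?addr0.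
  by rewrite dotZl dot_norm.
by move=> j ji; rewrite dotZl uo// mulr0.
Qed.

Lemma norm_sum_orthogonal (I : eqType) (u : I -> H) (c : I -> R[i]) (r : seq I) :
  (forall i j, i != j -> dot (u i) (u j) = 0) -> uniq r ->
  `|\sum_(j <- r) c j *: u j| ^+ 2 = \sum_(j <- r) `|c j| ^+ 2 * `|u j| ^+ 2.
Proof.
move=> uo ur; rewrite dot_norm dot_sumr big_seq [RHS]big_seq.
apply: eq_bigr => i ir; rewrite dotZr dot_sum_orthogonal// mulrA.
by rewrite normCK (mulrC _ (c i)).
Qed.

Lemma bessel u x n : subON u -> \sum_(0 <= i < n) `|dot x (u i)| ^+ 2 <= `|x| ^+ 2.
Proof.
move=> [uo u1]; set s := \sum_(0 <= i < n) _.
pose p := \sum_(0 <= i < n) dot x (u i) *: u i.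
have px : dot p x = s.
  rewrite dot_suml; apply: eq_bigr => i _.
  by rewrite dotZl (dotC (u i)) normCK.
have sR : s^* = s.
  by rewrite rmorph_sum; apply: eq_bigr => i _; rewrite rmorphXn/= conj_normC.
(* Only an inequality, since the [u i] may have norm below 1. *)
have pp : dot p p <= s.
  rewrite -dot_norm norm_sum_orthogonal ?iota_uniq//.
  apply: ler_sum => i _; rewrite -[leRHS]mulr1 ler_wpM2l ?exprn_ge0//.
  by rewrite exprn_ile1.
have := dnorm_ge0 dot (x - p).
rewrite dnormB/= (dotC x p) px !sR -dot_norm subr_ge0 => h.
by rewrite -(lerD2r s) (le_trans h)// lerD2l.
Qed.

(** Bessel for a sequence whose only nonzero term is [y / |y|]. *)
Lemma dot_CauchySchwarz x y : `|dot x y| <= `|x| * `|y|.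
Proof.
have [->|y0] := eqVneq y 0; first by rewrite linear0r !normr0 mulr0.
have ny0 : `|y| != 0 by rewrite normr_eq0.
pose u n := if n == 0%N then `|y|^-1 *: y else 0.
have uS : subON u.
  split=> [[|i] [|j]|[|i]] //=; rewrite /u/= ?linear0l ?linear0r ?normr0//.
  by rewrite normrZ normfV normr_id mulVf.
have := bessel x 1 uS; rewrite big_nat1 /u/= dotZr normrM norm_conjC.
rewrite normfV normr_id ler_sqr ?nnegrE ?mulr_ge0 ?invr_ge0//.
by rewrite mulrC ler_pdivrMr// lt_def ny0/=.
Qed.

(** * Diagonal operators between orthogonal sequences *)

Section Diagonal.
Variables (u w : nat -> H) (a : nat -> R[i]) (C : R[i]).
Hypotheses (uS : subON u) (wS : subON w) (aC : forall n, `|a n| <= C).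

Let term x n := (a n * dot x (u n)) *: w n.

(** The bound on [a] is asked only where [x] has a nonzero coefficient, so a vector orthogonal to
    the first eigenvectors can be estimated by the later eigenvalues alone. *)
Lemma norm_diag_block x (t : R[i]) m n :
  (forall k, dot x (u k) != 0 -> `|a k| <= t) ->
  `|\sum_(m <= k < n) term x k| ^+ 2 <=
    t ^+ 2 * \sum_(m <= k < n) `|dot x (u k)| ^+ 2.
Proof.
move=> at_; rewrite norm_sum_orthogonal ?iota_uniq//; last exact: wS.1.
rewrite mulr_sumr; apply: ler_sum => k _.
rewrite -[leRHS]mulr1 ler_pM ?exprn_ge0 ?exprn_ile1//; last exact: wS.2.
rewrite normrM exprMn; have [->|/at_ akt] := eqVneq (dot x (u k)) 0.
  by rewrite normr0 expr0n !mulr0.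
by rewrite ler_wpM2r ?exprn_ge0// ler_sqr ?nnegrE// (le_trans _ akt).
Qed.

(** Blocks of the series have squared norm at most [C ^ 2] times the matching blocks of the sum of
    [|dot x (u n)| ^ 2], which converges by Bessel; hence the Cauchy criterion. *)
Lemma diag_cvg x : cvg (series (term x) @ \oo).
Proof.
have C0 : 0 <= C by exact: le_trans (aC 0).
have C1 : 0 < C + 1 by rewrite ltr_wpDl.
(* Real parts give a series in [R], to which monotone convergence applies. *)
pose b n := complex.Re (`|dot x (u n)| ^+ 2).
have bE n : (b n)%:C%C = `|dot x (u n)| ^+ 2.
  by rewrite /b RRe_real// realX// normr_real.
have sbE m n : (\sum_(m <= k < n) b k)%:C%C = \sum_(m <= k < n) `|dot x (u k)| ^+ 2.
  by rewrite rmorph_sum; apply: eq_bigr => k _; rewrite /= bE.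
have b0 n : 0 <= b n by rewrite -lecR bE exprn_ge0.
have : cvg (series b @ \oo).
  apply: nondecreasing_is_cvgn.
    by apply: nondecreasing_series => n _ _.
  exists (complex.Re (`|x| ^+ 2)) => _ [n _ <-].
  rewrite -lecR sbE RRe_real ?realX ?normr_real//.
  exact: bessel.
move=> /cauchy_cvgP/cauchy_seriesP bcau.
apply/cauchy_cvgP/cauchy_seriesP => e e0.
pose d := (e / (C + 1)) ^+ 2.
have d0 : 0 < d by rewrite exprn_gt0// divr_gt0.
have dE : (complex.Re d)%:C%C = d by rewrite RRe_real// gtr0_real.
have /bcau : 0 < complex.Re d by rewrite -ltcR dE.
apply: filterS => -[m n] /=.
rewrite ger0_norm ?sumr_ge0// -ltcR dE sbE => bd.
rewrite -ltr_sqr ?nnegrE ?(ltW e0)//.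
apply: (@le_lt_trans _ _ (C ^+ 2 * \sum_(m <= k < n) `|dot x (u k)| ^+ 2)).
  by apply: norm_diag_block => k _.
apply: (@le_lt_trans _ _ ((C + 1) ^+ 2 * \sum_(m <= k < n) `|dot x (u k)| ^+ 2)).
  apply: ler_wpM2r; first by apply: sumr_ge0 => k _; rewrite exprn_ge0.
  by rewrite ler_sqr ?nnegrE ?(ltW C1)// lerDl.
rewrite mulrC -ltr_pdivlMr ?exprn_gt0//.
by rewrite -expr_div_n.
Qed.

End Diagonal.

Lemma norm_cvg_le (s : nat -> H) (l : H) (M : R[i]) :
  s @ \oo --> l -> (forall n, `|s n| <= M) -> `|l| <= M.
Proof.
move=> /cvgrPdist_le sl sM; apply/ler_addgt0Pr => e /sl [n _ /(_ n (leqnn n)) lsn].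
by rewrite -(subrK (s n) l) addrC (le_trans (ler_normD _ _))// lerD.
Qed.

Lemma cvg_dotl (s : nat -> H) (l y : H) :
  s @ \oo --> l -> dot (s n) y @[n --> \oo] --> dot l y.
Proof.
move=> /cvgrPdist_le sl; apply/cvgrPdist_le => e e0.
have y1 : 0 < `|y| + 1 by rewrite ltr_wpDl.
have /sl : 0 < e / (`|y| + 1) by rewrite divr_gt0.
apply: filterS => n /= lsn.
have -> : dot l y - dot (s n) y = dot (l - s n) y by rewrite linearBl.
rewrite (le_trans (dot_CauchySchwarz _ _))//.
rewrite (le_trans (ler_wpM2r (normr_ge0 y) lsn))// mulrAC ler_pdivrMr//.
by rewrite ler_wpM2l ?(ltW e0)// lerDl.
Qed.

Lemma cvg_dotr (s : nat -> H) (l x : H) :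
  s @ \oo --> l -> dot x (s n) @[n --> \oo] --> dot x l.
Proof.
move=> /(@cvg_dotl _ _ x)/cvgrPdist_le sl; apply/cvgrPdist_le => e /sl.
apply: filterS => n /=.
by rewrite (dotC x l) (dotC x (s n)) -rmorphB norm_conjC.
Qed.

Definition is_diag (a : nat -> R[i]) u w (Z : bounded_op H) := forall x,
  (\sum_(0 <= k < n) (a k * dot x (u k)) *: w k) @[n --> \oo] --> Z x.

Lemma norm_diag_partial_sum (a : nat -> R[i]) u w (t : R[i]) x n :
  subON u -> subON w -> 0 <= t ->
  (forall k, dot x (u k) != 0 -> `|a k| <= t) ->
  `|\sum_(0 <= k < n) (a k * dot x (u k)) *: w k| <= t * `|x|.
Proof.
move=> uS wS t0 at_; rewrite ler_norm_sqr ?mulr_ge0// exprMn.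
apply: le_trans (norm_diag_block wS _ _ at_) _.
by rewrite ler_wpM2l ?exprn_ge0// bessel.
Qed.

Lemma diag_exists (a : nat -> R[i]) u w (C : R[i]) :
  subON u -> subON w -> (forall n, `|a n| <= C) ->
  exists Z, is_diag a u w Z.
Proof.
move=> uS wS aC; have C0 : 0 <= C by exact: le_trans (aC 0).
pose s x n := \sum_(0 <= k < n) (a k * dot x (u k)) *: w k.
have sl x : s x @ \oo --> lim (s x @ \oo) by exact: (diag_cvg uS wS aC).
have Zlin : linear (fun x => lim (s x @ \oo)).
  move=> k x y; apply: cvg_lim => //.
  rewrite (_ : s _ = fun n => k *: s x n + s y n); last first.
    apply/funext => n; rewrite /s scaler_sumr -big_split; apply: eq_bigr => i _ /=.
    by rewrite linearDl /= dotZl mulrDr scalerDl scalerA mulrCA.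
  exact: cvgD (cvgZ (cvg_cst _) (sl x)) (sl y).
have Zbd : exists M : R[i], forall x, `|lim (s x @ \oo)| <= M * `|x|.
  exists C => x; apply: (norm_cvg_le (sl x)) => n.
  by apply: norm_diag_partial_sum => // k _; exact: aC.
by exists (BoundedOp Zlin Zbd).
Qed.

Section DiagTheory.
Variables (a : nat -> R[i]) (u w : nat -> H) (Z : bounded_op H).
Hypotheses (uS : subON u) (wS : subON w) (Zd : is_diag a u w Z).

Lemma diag_norm_le x (t : R[i]) : 0 <= t ->
  (forall k, dot x (u k) != 0 -> `|a k| <= t) -> `|Z x| <= t * `|x|.
Proof.
by move=> t0 at_; apply: (norm_cvg_le (@Zd x)) => n; exact: norm_diag_partial_sum.
Qed.

(** The factor [|u n| ^ 2] accounts for vectors that are zero or shorter than unit vectors. *)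
Lemma diag_basis n : Z (u n) = (a n * `|u n| ^+ 2) *: w n.
Proof.
apply: (cvg_unique _ (@Zd (u n))) => //.
apply: cvg_near_cst; exists n.+1 => // m /= nm.
rewrite (bigD1_seq n) ?iota_uniq ?mem_index_iota//= -dot_norm big1 ?addr0//.
by move=> k kn; rewrite uS.1 1?eq_sym// mulr0 scale0r.
Qed.

End DiagTheory.

(** True termwise for real coefficients, then in the limit by continuity of [dot]. *)
Lemma diag_sym (a : nat -> R[i]) u (Z : bounded_op H) x y :
  (forall n, a n \is Num.real) -> is_diag a u u Z -> dot (Z x) y = dot x (Z y).
Proof.
move=> aR Zd; have := cvg_dotl (y := y) (Zd x).
rewrite (_ : (fun n => _) = fun n =>
  dot x (\sum_(0 <= k < n) (a k * dot y (u k)) *: u k)).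
  by move/cvg_unique; apply=> //; exact: cvg_dotr.
apply/funext => n; rewrite dot_suml dot_sumr; apply: eq_bigr => k _.
rewrite dotZl dotZr rmorphM/= conj_Creal// -(dotC (u k)).
by rewrite -!mulrA (mulrC (dot x _)).
Qed.

(** * Finitely many linear conditions *)

Lemma bopZ (A : bounded_op H) (k : R[i]) x : A (k *: x) = k *: A x.
Proof. by rewrite linearZ. Qed.

Lemma linearB_fun (V : lmodType R[i]) (f : H -> V) x y :
  linear f -> f (x - y) = f x - f y.
Proof. by move=> flin; have := flin (-1) y x; rewrite !scaleN1r !(addrC (- _)). Qed.

Lemma linear_lincomb (V : lmodType R[i]) (f : H -> V) n (c : 'I_n -> R[i])
    (y : 'I_n -> H) : linear f ->
  f (\sum_i c i *: y i) = \sum_i c i *: f (y i).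
Proof.
move=> flin; have f0 : f 0 = 0 by rewrite -(subrr 0) linearB_fun// subrr.
apply: (big_ind2 (fun x z => f x = z)) => [//|x1 z1 x2 z2 <- <-|i _].
  by rewrite -[x1]scale1r flin !scale1r.
by rewrite -[X in f X]addr0 flin f0 addr0.
Qed.

(** Dimension count: [c] is a left kernel vector of the matrix with rows [phi (y i)]. *)
Lemma exists_lincomb_kernel m (phi : H -> 'rV[R[i]]_m) N (y : 'I_N -> H) :
  linear phi -> (m < N)%N ->
  exists2 c : 'I_N -> R[i], exists i, c i != 0 & phi (\sum_i c i *: y i) = 0.
Proof.
move=> philin mN.
have [c c0 cM] := exists_left_kernel (\matrix_i phi (y i)) mN.
exists (c 0).
  apply: contrapT => /forallNP c_0; move/eqP: c0; apply.
  by apply/rowP => i; rewrite mxE; apply/eqP; apply: contrapT => /negP/c_0.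
rewrite linear_lincomb// -[RHS]cM mulmx_sum_row.
by apply: eq_bigr => i _; rewrite rowK.
Qed.

(* A finite set of [y i] such that the [phi (y i)] span the range of [phi]
   yields the spanning set [A (y i)] of the range of [A]. *)
Lemma finite_rank_of_kernel m (phi : H -> 'rV[R[i]]_m) (A : bounded_op H) :
  linear phi -> (forall x, phi x = 0 -> A x = 0) -> finite_rank A.
Proof.
move=> philin phiA.
pose P (r : nat) := `[< exists k (y : 'I_k -> H), \rank (\matrix_i phi (y i)) = r >].
have P0 : exists r, P r.
  pose y0 (_ : 'I_0) : H := 0.
  by exists (\rank (\matrix_i phi (y0 i))); apply/asboolP; exists 0%N, y0.
have Pm r : P r -> (r <= m)%N by move=> /asboolP[k [y <-]]; exact: rank_leq_col.
case: (ex_maxnP P0 Pm) => r /asboolP[k [y yr]] rmax.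
exists k, (A \o y) => x; pose M := \matrix_i phi (y i).
(* As [r] is maximal, the additional row [phi x] cannot raise the rank. *)
have /submxP[c cM] : (phi x <= M)%MS.
  pose y' (i : 'I_(1 + k)) := match fintype.split i with inl _ => x | inr j => y j end.
  have y'E : \matrix_i phi (y' i) = col_mx (phi x) M.
    apply/matrixP => i j; rewrite !mxE /y'.
    by case: fintype.split => l; rewrite ?mxE// ord1.
  have /rmax : P (\rank (col_mx (phi x) M)).
    by apply/asboolP; exists (1 + k)%N, y'; rewrite y'E.
  rewrite -yr => rle.
  have MM' : (M <= col_mx (phi x) M)%MS by rewrite -addsmxE addsmxSr.
  have : (col_mx (phi x) M <= M)%MS.
    by rewrite -(geq_leqif (mxrank_leqif_sup MM')).
  by rewrite col_mx_sub => /andP[].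
exists (c 0); apply/eqP; rewrite -subr_eq0; apply/eqP.
rewrite -(linear_lincomb _ _ (@bop_linear _ _ A)) -linearB; apply: phiA.
rewrite linearB_fun// linear_lincomb// cM mulmx_sum_row.
by apply/eqP; rewrite subr_eq0; apply/eqP/eq_bigr => i _; rewrite rowK.
Qed.

(** Unit vectors are chosen greedily, orthogonal to the earlier ones, with images orthogonal to the
    earlier images and longer than [eps]. If the choice is stuck at a list [s], these [2 * size s]
    orthogonality conditions form [phi]. *)
Lemma small_finite_codim_or_ON (X : bounded_op H) (eps : R[i]) : 0 <= eps ->
  (exists m (phi : H -> 'rV[R[i]]_m), linear phi /\
     forall x, phi x = 0 -> `|X x| <= eps * `|x|) \/
  exists v, [/\ ON v, forall i j, i != j -> dot (X (v i)) (X (v j)) = 0 &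
                forall i, eps < `|X (v i)|].
Proof.
move=> eps0.
pose P (s : seq H) x := [/\ `|x| = 1, forall y, y \in s -> dot x y = 0,
  forall y, y \in s -> dot (X x) (X y) = 0 & eps < `|X x|].
have [/seq_choice[v Pv]|/existsNP[s /forallNP Ps]] :=
    pselect (forall s, exists x, P s x); [right|left].
  have vmem i j : (i < j)%N -> v i \in mkseq v j.
    by move=> ij; apply/mapP; exists i; rewrite ?mem_iota.
  exists v; split=> [i j|i j|i]; last by case: (Pv i).
    have [ij|ij|->] := ltngtP i j.
    - by case: (Pv j) => _ /(_ _ (vmem _ _ ij))/dot_eq0C.
    - by case: (Pv i) => _ /(_ _ (vmem _ _ ij)).
    - by rewrite -dot_norm; case: (Pv j) => -> _ _ _; rewrite expr1n.
  have [ij|ij|->] := ltngtP i j; last by [].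
    by case: (Pv j) => _ _ /(_ _ (vmem _ _ ij))/dot_eq0C.
  by case: (Pv i) => _ _ /(_ _ (vmem _ _ ij)).
pose n := size s.
pose phi x : 'rV[R[i]]_(n + n) := row_mx (\row_i dot x (nth 0 s i))
  (\row_i dot (X x) (X (nth 0 s i))).
exists (n + n)%N, phi; split.
  move=> k x y; rewrite /phi scale_row_mx add_row_mx.
  have dotP z z' z'' : dot (k *: z + z') z'' = k * dot z z'' + dot z' z''.
    by rewrite linearDl /= dotZl.
  by congr row_mx; apply/rowP => i; rewrite !mxE ?bop_linear dotP.
move=> x phix; have [->|x0] := eqVneq x 0; first by rewrite linear0 !normr0 mulr0.
have nx : 0 < `|x| by rewrite normr_gt0.
have /eq_row_mx[/rowP x1 /rowP x2] : phi x = row_mx 0 0 by rewrite row_mx0.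
rewrite real_leNgt ?realM ?normr_real ?ger0_real//; apply/negP => epsX.
apply: (Ps (`|x|^-1 *: x)); split.
- by rewrite normrZ normfV normr_id mulVf ?gt_eqF.
- move=> y /(nthP 0)[i si <-]; rewrite dotZl.
  by have := x1 (Ordinal si); rewrite !mxE/= => ->; rewrite mulr0.
- move=> y /(nthP 0)[i si <-]; rewrite bopZ dotZl.
  by have := x2 (Ordinal si); rewrite !mxE/= => ->; rewrite mulr0.
- by rewrite bopZ normrZ normfV normr_id mulrC ltr_pdivlMr.
Qed.

(** * Finite rank operators and their semigroup-ideals *)

Lemma finite_rank_no_ON (A : bounded_op H) (y : nat -> H) :
  finite_rank A -> ~ ON (A \o y).
Proof.
move=> [m [e Ae]] yON; have [c cE] := choice (fun i : 'I_m.+1 => Ae (y i)).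
have [d d0 dM] := exists_left_kernel (\matrix_(i, j) c i j) (ltnSn m).
have dA0 : \sum_(i < m.+1) d 0 i *: A (y i) = 0.
  under eq_bigr => i _ do rewrite cE scaler_sumr.
  rewrite exchange_big/= big1// => j _.
  under eq_bigr => i _ do rewrite scalerA.
  rewrite -scaler_suml; have /rowP/(_ j) := dM; rewrite !mxE => dM0.
  rewrite (_ : \sum_i _ = 0) ?scale0r// -[RHS]dM0.
  by apply: eq_bigr => i _; rewrite mxE.
move/eqP: d0; apply; apply/rowP => i; rewrite mxE.
have : dot (\sum_(i < m.+1) d 0 i *: A (y i)) (A (y i)) = 0 by rewrite dA0 linear0l.
rewrite dot_suml (bigD1 i)//= big1 ?addr0; last first.
  move=> j ji; rewrite dotZl (yON j i).
  by rewrite (negPf (ji : (j : nat) != i)) mulr0.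
by rewrite dotZl (yON i i) eqxx mulr1.
Qed.

(** Points with orthonormal images are added greedily; finite rank forces a stop. A nonzero residual
    [A r] could be normalised and would prolong the final list. Preimages are recorded because the
    right factor [Y] is built from them. *)
Lemma finite_rank_basis (A : bounded_op H) : finite_rank A ->
  exists s : seq H, forall x,
    A x = \sum_(y <- s) dot (A x) (A y) *: A y.
Proof.
move=> Afr; pose G s := forall i j, (i < size s)%N -> (j < size s)%N ->
  dot (A (nth 0 s i)) (A (nth 0 s j)) = (i == j)%:R.
(* Vacuous on lists that fail [G]; hence a list that cannot be prolonged satisfies [G]. *)
pose P s y := G s -> G (rcons s y).
have [/seq_choice[y Py]|/existsNP[s /forallNP Ps]] :=
    pselect (forall s, exists x, P s x).
  exfalso; apply: (@finite_rank_no_ON A y Afr) => i j.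
  have Gy n : G (mkseq y n).
    by elim: n => [//|n IH]; rewrite mkseqS; exact: Py.
  have := Gy (i + j).+1 i j; rewrite !size_mkseq !nth_mkseq ?ltnS ?leq_addr ?leq_addl//.
  by apply.
have Gs : G s by apply: contrapT => nG; apply: (Ps 0).
exists s => x; apply: contrapT => Ax.
pose r := x - \sum_(y <- s) dot (A x) (A y) *: y.
have ArE : A r = A x - \sum_(y <- s) dot (A x) (A y) *: A y.
  by rewrite linearB linear_sum; congr (_ - _); apply: eq_bigr => y _; rewrite linearZ.
have Ar0 : A r != 0 by rewrite ArE subr_eq0; apply/eqP.
have nAr : `|A r| != 0 by rewrite normr_eq0.
have Aro i : (i < size s)%N -> dot (A r) (A (nth 0 s i)) = 0.
  move=> si; rewrite ArE linearBl /= dot_suml (big_nth 0) big_mkord.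
  rewrite (bigD1 (Ordinal si))//= big1 ?addr0; last first.
    move=> j ji; rewrite dotZl Gs//.
    by rewrite (negPf (ji : (j : nat) != i)) mulr0.
  by rewrite dotZl Gs// eqxx mulr1 subrr.
apply: (Ps (`|A r|^-1 *: r)) => _ i j; rewrite size_rcons !ltnS !nth_rcons.
rewrite [(i <= _)%N]leq_eqVlt [(j <= _)%N]leq_eqVlt => /orP[/eqP->|is_] /orP[/eqP->|js].
- rewrite ltnn !eqxx bopZ -dot_norm normrZ normfV normr_id mulVf//.
  by rewrite expr1n.
- by rewrite ltnn eqxx js bopZ dotZl Aro// mulr0 gtn_eqF.
- by rewrite ltnn eqxx is_ bopZ (dotC (A _)) dotZl Aro// mulr0 rmorph0 ltn_eqF.
- by rewrite is_ js Gs.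
Qed.

Fact rank1_linear (p q : H) : linear (fun x => dot x p *: q).
Proof. by move=> k x y; rewrite linearDl /= dotZl scalerDl scalerA. Qed.

Fact rank1_bounded (p q : H) :
  exists M : R[i], forall x, `|dot x p *: q| <= M * `|x|.
Proof.
exists (`|p| * `|q|) => x; rewrite normrZ mulrAC ler_wpM2r//.
by rewrite mulrC dot_CauchySchwarz.
Qed.

Definition rank1 (p q : H) := BoundedOp (rank1_linear p q) (rank1_bounded p q).

Lemma bop_sumE (I : Type) (r : seq I) (A : I -> bounded_op H) x :
  (\sum_(i <- r) A i) x = \sum_(i <- r) A i x.
Proof. by apply: (big_ind2 (fun (B : bounded_op H) z => B x = z)) => // ? ? ? ? <- <-. Qed.

Lemma finite_rank_sum_rank1 (s : seq H) (p q : H -> H) :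
  finite_rank (\sum_(y <- s) rank1 (p y) (q y)).
Proof.
exists (size s), (fun i => q (nth 0 s i)) => x.
exists (fun i => dot x (p (nth 0 s i))).
by rewrite bop_sumE (big_nth 0) big_mkord.
Qed.

Lemma finite_rankMl (A B : bounded_op H) : finite_rank A -> finite_rank (B * A).
Proof.
move=> [n [e Ae]]; exists n, (B \o e) => x; have [c Ax] := Ae x; exists c.
rewrite [LHS](_ : _ = B (A x))// Ax.
exact: (linear_lincomb _ _ (@bop_linear _ _ B)).
Qed.

Lemma finite_rank0 : finite_rank (0 : bounded_op H).
Proof. by exists 0%N, (fun=> 0) => x; exists (fun=> 0); rewrite big_ord0. Qed.

(* If [P] is the projection on the range of [A] and [A Y = P], then
   [A^* = A^* P = A^* A Y]. The default value [0] of [adjoint] is handled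
   separately, which spares the Riesz theorem. *)
Lemma finite_rank_SI : SI_semigroup dot (@finite_rank _ H).
Proof.
split=> [A B _|J [JF Jid] _ [A JA <-]]; first exact: finite_rankMl.
rewrite /adjoint; case: xgetP => [B _ AB|_]; last first.
  by rewrite -(mul0r A); case: (Jid _ _ JA finite_rank0).
have [s sA] := finite_rank_basis (JF _ JA).
pose P := \sum_(y <- s) rank1 (A y) (A y).
pose Y := \sum_(y <- s) rank1 (A y) y.
have AY : A * Y = P.
  apply: bopP => x; rewrite [LHS](_ : _ = A (Y x))// !bop_sumE linear_sum.
  by apply: eq_bigr => y _; rewrite linearZ.
(* Adjoint form of [P * A = A]. *)
have BP : B * P = B.
  apply: bopP => x; apply: dot_eqr => z; rewrite -!AB [in RHS]sA bop_sumE.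
  rewrite dot_suml dot_sumr; apply: eq_bigr => y _ /=.
  by rewrite dotZl dotZr mulrC -dotC.
(* Multiplying by [B] stays in [J] only once [B] is known to lie in F(H). *)
have BF : finite_rank B by rewrite -BP; apply/finite_rankMl/finite_rank_sum_rank1.
rewrite -BP -AY mulrA.
have [JBA _] := Jid _ _ JA BF.
by have [] := Jid _ _ JBA (finite_rank_sum_rank1 s A id).
Qed.

(** * Nonzero ideals contain F(H) *)

Lemma two_sided_ideal_sum (I : set (bounded_op H)) (s : seq H) A :
  two_sided_ideal I -> (forall y, I (A y)) -> I (\sum_(y <- s) A y).
Proof.
move=> [I0 IB _] IA; apply: (big_ind I) => // B C IB_ IC.
by rewrite -[C]opprK; apply: (IB) => //; rewrite -sub0r; exact: IB.
Qed.

(** A nonzero [Z] in [I], placed between two rank one operators, yields every rank one operator; the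
    projection on the range of [A] is a sum of these. *)
Lemma finite_rank_sub_ideal (I : set (bounded_op H)) :
  two_sided_ideal I -> I <> [set 0] -> @finite_rank _ H `<=` I.
Proof.
move=> Iid I0 A Afr; have [IO _ IM] := Iid.
have [Z IZ Z0] : exists2 Z, I Z & Z <> 0.
  apply: contrapT => nZ; apply: I0; apply/seteqP; split=> [Z IZ|_ ->//].
  by apply: contrapT => Z0; apply: nZ; exists Z.
have [a Za] : exists a, Z a != 0.
  apply: contrapT => /forallNP nZ; apply: Z0; apply: bopP => x.
  by apply/eqP; apply: contrapT => /negP/nZ.
have Zn : `|Z a| ^+ 2 != 0 by rewrite expf_eq0/= normr_eq0.
have Irank1 p q : I (rank1 p q).
  rewrite (_ : rank1 p q = rank1 (Z a) ((`|Z a| ^+ 2)^-1 *: q) * (Z * rank1 p a)).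
    by apply: (IM _ _ _).1; apply: (IM _ _ _).2.
  apply: bopP => x /=; rewrite bopZ dotZl -dot_norm scalerA.
  by rewrite mulfK.
have [s sA] := finite_rank_basis Afr.
rewrite (_ : A = (\sum_(y <- s) rank1 (A y) (A y)) * A).
  by apply: (IM _ _ _).2; exact: two_sided_ideal_sum.
by apply: bopP => x; rewrite [RHS]bop_sumE -sA.
Qed.

(** * Continuity, density and Gram-Schmidt in a separable space *)

Lemma bop_cvg (B : bounded_op H) (s : nat -> H) (l : H) :
  s @ \oo --> l -> B (s n) @[n --> \oo] --> B l.
Proof.
have [M M0 BM] := bop_bounded_ge0 B.
move=> /cvgrPdist_le sl; apply/cvgrPdist_le => e e0.
have M1 : 0 < M + 1 by rewrite ltr_wpDl.
have /sl : 0 < e / (M + 1) by rewrite divr_gt0.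
apply: filterS => n /= lsn; rewrite -linearB (le_trans (BM _))//.
rewrite (le_trans (ler_wpM2l M0 lsn))// mulrCA ger_pMr// ler_pdivrMr// mul1r.
by rewrite lerDl.
Qed.

Lemma diag_comp (a k : nat -> R[i]) u w w' (Z B : bounded_op H) :
  is_diag a u w Z -> (forall n, B (w n) = k n *: w' n) ->
  is_diag (fun n => a n * k n) u w' (B * Z).
Proof.
move=> Zd Bw x; have := bop_cvg (B := B) (Zd x).
rewrite (_ : (fun n => _) = fun n =>
  \sum_(0 <= i < n) (a i * k i * dot x (u i)) *: w' i)//.
apply/funext => n; rewrite linear_sum; apply: eq_bigr => i _.
by rewrite linearZ/= Bw scalerA mulrAC.
Qed.

Lemma bop_eq1_dense (D : set H) (Z : bounded_op H) :
  dense D -> (forall x, D x -> Z x = x) -> Z = 1.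
Proof.
move=> Dd ZD; apply: bopP => x; have [M M0 ZM] := bop_bounded_ge0 Z.
have M1 : 0 < M + 1 by rewrite ltr_wpDl.
apply/eqP; rewrite -subr_eq0 -normr_le0; apply/ler_addgt0Pr => e e0.
have e1 : 0 < e / (M + 1) by rewrite divr_gt0.
have [y [/= xy /ZD Zy]] : ball x (e / (M + 1)) `&` D !=set0.
  by apply: Dd; [exists x; exact: ballxx|exact: ball_open].
rewrite add0r [X in `|X|](_ : _ = Z (x - y) - (x - y)); last first.
  by rewrite linearB /= Zy opprB addrA subrK.
rewrite (le_trans (ler_normB _ _))//.
move: xy; rewrite -ball_normE /= => /ltW xy.
rewrite -[e](divfK (lt0r_neq0 M1)) [leRHS]mulrC mulrDl mul1r lerD//.
by rewrite (le_trans (ZM _))// ler_wpM2l.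
Qed.

(** Gram-Schmidt along an enumeration of a dense set. Zero vectors are allowed for points already in
    the span of the earlier ones, which also covers finite dimension. The last clause is totality in
    the form needed to recognise the identity. *)
Lemma separable_basis : separable_space H ->
  exists e : nat -> H, [/\ forall i j, i != j -> dot (e i) (e j) = 0,
    forall n, e n = 0 \/ `|e n| = 1 &
    forall Z : bounded_op H, (forall n, Z (e n) = e n) -> Z = 1].
Proof.
move=> [D [/countable_injP[f finj] Dd]].
(* [d] inverts the injection [f]; indices outside its image get 0. *)
pose d n := xget 0 [set x | D x /\ f x = n].
have dD x : D x -> d (f x) = x.
  move=> Dx; apply: xget_unique => //= y [Dy].
  by apply: finj; rewrite inE.
pose G s := (forall i j, (i < size s)%N -> (j < size s)%N -> i != j ->
    dot (nth 0 s i) (nth 0 s j) = 0) /\ (forall y, y \in s -> y = 0 \/ `|y| = 1).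
pose P s x := G s -> G (rcons s x) /\
  exists k, d (size s) = \sum_(y <- s) dot (d (size s)) y *: y + k *: x.
have /seq_choice[e Pe] : forall s, exists x, P s x.
  move=> s; have [[Go Gn]|nG] := pselect (G s); last by exists 0 => /nG.
  set dn := d (size s); pose r := dn - \sum_(y <- s) dot dn y *: y.
  have ro i : (i < size s)%N -> dot r (nth 0 s i) = 0.
    move=> si; rewrite /r linearBl /= dot_suml (big_nth 0) big_mkord.
    rewrite (bigD1 (Ordinal si))//= big1 ?addr0; last first.
      by move=> j ji; rewrite dotZl Go// mulr0.
    rewrite dotZl -dot_norm.
    have [->|->] := Gn _ (mem_nth 0 si); first by rewrite linear0r mul0r subrr.
    by rewrite expr1n mulr1 subrr.
  have [x [k kx]] : exists x k, [/\ dot x x = 0 \/ `|x| = 1,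
      forall i, (i < size s)%N -> dot x (nth 0 s i) = 0 & r = k *: x].
    have [r0|r0] := eqVneq r 0.
      exists 0, 0; split; rewrite ?scaler0//; first by left; rewrite linear0l.
      by move=> i _; rewrite linear0l.
    have nr : `|r| != 0 by rewrite normr_eq0.
    exists (`|r|^-1 *: r), `|r|; split; last by rewrite scalerA divff// scale1r.
      by right; rewrite normrZ normfV normr_id mulVf.
    by move=> i si; rewrite dotZl ro// mulr0.
  case: kx => xn xo rx.
  exists x => _; split; last first.
    by exists k; rewrite -rx addrC subrK.
  split=> [i j|y].
    rewrite size_rcons !ltnS !nth_rcons.
    rewrite [(i <= _)%N]leq_eqVlt [(j <= _)%N]leq_eqVlt.
    move=> /orP[/eqP->|is_] /orP[/eqP->|js] ij.
    - by rewrite eqxx in ij.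
    - by rewrite ltnn eqxx js xo.
    - by rewrite ltnn eqxx is_; apply/dot_eq0C/xo.
    - by rewrite is_ js Go.
  rewrite mem_rcons inE => /orP[/eqP->|/Gn//].
  by case: xn => [/eqP|->]; [rewrite dnorm_eq0 => /eqP; left|right].
have Ge n : G (mkseq e n).
  by elim: n => [|n IH]; [split|rewrite mkseqS; have [] := Pe n IH].
exists e; split=> [i j ij|n|Z Ze].
- have := (Ge (i + j).+1).1 i j; rewrite !size_mkseq !nth_mkseq ?ltnS ?leq_addr ?leq_addl//.
  by apply.
- apply: (Ge n.+1).2; apply/mapP; exists n => //.
  by rewrite mem_iota/= add0n.
- apply: (bop_eq1_dense Dd) => x /dD <-.
  have [_ []] := Pe (f x) (Ge _); rewrite size_mkseq => k dE.
  have ZD a b : Z (a + b) = Z a + Z b by rewrite linearD.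
  rewrite dE ZD bopZ Ze linear_sum; congr (_ + _).
  rewrite big_seq [RHS]big_seq; apply: eq_bigr => y /mapP[i _ ->].
  by rewrite /= bopZ Ze.
Qed.

Lemma ON_normalize (y : nat -> H) :
  (forall i j, i != j -> dot (y i) (y j) = 0) -> (forall i, y i != 0) ->
  ON (fun i => `|y i|^-1 *: y i).
Proof.
move=> yo y0 i j; rewrite dotZl dotZr; have [<-|/yo->] := eqVneq i j.
  have ny : `|y i| != 0 by rewrite normr_eq0.
  by rewrite conj_Creal ?realV ?normr_real// -dot_norm expr2 mulKf ?mulVf.
by rewrite !mulr0.
Qed.

(** * Proper ideals and the plateau operator *)

(** This is compactness, phrased through finitely many linear conditions to suit a dimension
    count. *)
Definition essentially_small (X : bounded_op H) := forall eps : R[i], 0 < eps ->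
  exists m (phi : H -> 'rV[R[i]]_m), linear phi /\
    forall x, phi x = 0 -> `|X x| <= eps * `|x|.

(* Otherwise [X] maps an orthonormal sequence to an orthogonal sequence bounded
   away from [0], and [W X V = 1] for suitable [V] and [W]. *)
Lemma proper_ideal_small (I : set (bounded_op H)) (X : bounded_op H) :
  separable_space H -> two_sided_ideal I -> I <> setT -> I X ->
  essentially_small X.
Proof.
move=> Hsep [_ _ IM] IT IX eps eps0.
case: (small_finite_codim_or_ON X (ltW eps0)) => [//|[v [vON Xvo Xveps]]].
exfalso; apply: IT.
have [e [eo e01 etot]] := separable_basis Hsep.
have eS : subON e.
  by split=> // n; case: (e01 n) => ->; rewrite ?normr0.
have Xv0 i : 0 < `|X (v i)| by exact: lt_trans (Xveps i).
pose u i := `|X (v i)|^-1 *: X (v i).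
have uON : ON u.
  by apply: ON_normalize => // i; rewrite -normr_gt0.
have [V Vd] : exists V, is_diag (fun=> 1) e v V.
  by apply: (diag_exists (C := 1) eS (ON_subON vON)) => n; rewrite normr1.
(* Bounded by [eps^-1], because every [|X (v i)|] exceeds [eps]. *)
have [W Wd] : exists W, is_diag (fun i => `|X (v i)|^-1) u e W.
  apply: (diag_exists (C := eps^-1) (ON_subON uON) eS) => n.
  by rewrite normfV normr_id lef_pV2 ?posrE// ltW.
have WXV : W * X * V = 1.
  apply: etot => n; rewrite [LHS](_ : _ = W (X (V (e n))))//.
  rewrite (diag_basis eS Vd) mul1r !bopZ.
  have -> : X (v n) = `|X (v n)| *: u n.
    by rewrite scalerA divff ?scale1r// gt_eqF.
  rewrite bopZ (diag_basis (ON_subON uON) Wd) (dot_norm (u n)) uON eqxx mulr1.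
  rewrite (scalerA `|X (v n)|) divff ?gt_eqF// scale1r.
  by case: (e01 n) => ->; rewrite ?scaler0// expr1n scale1r.
apply/seteqP; split=> // A _; rewrite -[A]mulr1 -WXV.
by apply: (IM _ _ _).1; apply: (IM _ _ _).2; apply: (IM _ _ _).1.
Qed.

(** [T] is [W * A * V], where [V] projects on the closed span of the [v i] and [W] sends [A (v i)]
    to [t i *: v i]. Boundedness of [W] only needs [t i] below a fixed multiple of [|A (v i)|],
    which leaves room to make [t] constant on dyadic blocks. *)
Lemma plateau_diagonal (I : set (bounded_op H)) (A : bounded_op H) :
  two_sided_ideal I -> I A -> ~ finite_rank A ->
  exists v (t tau : nat -> R[i]) (T : bounded_op H),
    [/\ ON v, is_diag t v v T, I T, forall k, 0 < tau k &
        forall k n, ((n < 2 ^ k.+1)%N -> tau k <= t n) /\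
                    ((2 ^ k <= n)%N -> 0 < t n <= tau k)].
Proof.
move=> [_ _ IM] IA Afr.
(* With bound 0 the first alternative makes [A] vanish on the kernel of [phi]. *)
case: (small_finite_codim_or_ON A (lexx 0)) => [[m [phi [philin phiA]]]|].
  exfalso; apply: Afr; apply: (finite_rank_of_kernel philin) => x /phiA.
  by rewrite mul0r normr_le0 => /eqP.
move=> [v [vON Avo Av0]]; have vS := ON_subON vON.
have [M M0 AM] := bop_bounded_ge0 A.
have M1 : 0 < M + 1 by rewrite ltr_wpDl.
pose q i := `|A (v i)| / (M + 1).
have q0 i : 0 < q i by rewrite divr_gt0.
have q1 i : q i <= 1.
  rewrite ler_pdivrMr// mul1r (le_trans (AM _))//.
  by rewrite (le_trans (ler_wpM2l M0 (vS.2 i)))// mulr1 lerDl.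
pose g m := \prod_(0 <= i < m) q i.
have g0 m : 0 < g m by rewrite prodr_gt0.
have g_decr m n : (m <= n)%N -> g n <= g m.
  move=> mn; rewrite /g (big_cat_nat (n := m))//= -[leRHS]mulr1.
  rewrite ler_wpM2l ?(ltW (g0 m))//; apply: prodr_ile1 => i _.
  by rewrite ltW ?q1.
have g_le n m : (n < m)%N -> g m <= q n.
  move=> nm; rewrite (le_trans (g_decr _ _ nm))// /g big_nat_recr//=.
  rewrite -[leRHS]mul1r ler_wpM2r ?(ltW (q0 n))//; apply: prodr_ile1 => i _.
  by rewrite ltW ?q1.
pose tau k := g (2 ^ k.+1)%N.
pose t n := tau (trunc_log 2 n).
have t0 n : 0 < t n by exact: g0.
have tq n : t n <= q n by apply: g_le; rewrite trunc_log_ltn.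
pose u i := `|A (v i)|^-1 *: A (v i).
have uON : ON u by apply: ON_normalize => // i; rewrite -normr_gt0.
have [V Vd] : exists V, is_diag (fun=> 1) v v V.
  by apply: (diag_exists (C := 1) vS vS) => n; rewrite normr1.
have [W Wd] : exists W, is_diag (fun i => t i / `|A (v i)|) u v W.
  apply: (diag_exists (C := (M + 1)^-1) (ON_subON uON) vS) => n.
  rewrite ger0_norm ?divr_ge0 ?(ltW (t0 n))// ler_pdivrMr// mulrC.
  exact: tq.
exists v, t, tau, (W * A * V); split=> [//|||k|k n].
- have -> : t = fun n => 1 * t n by apply/funext => n; rewrite mul1r.
  apply: (diag_comp Vd) => n; rewrite [LHS](_ : _ = W (A (v n)))//.
  have -> : A (v n) = `|A (v n)| *: u n.
    by rewrite scalerA divff ?scale1r// gt_eqF.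
  rewrite bopZ (diag_basis (ON_subON uON) Wd) (dot_norm (u n)) uON eqxx mulr1.
  by rewrite scalerA mulrC divfK// gt_eqF.
- by apply: (IM _ _ _).2; apply: (IM _ _ _).1.
- exact: g0.
- split=> kn; last rewrite t0/=; apply: g_decr; rewrite leq_exp2l// ltnS.
    (* [trunc_log 2 0] is 0, so the index 0 joins the first block. *)
    case: n kn => [|n] kn; first by rewrite trunc_log0.
    by rewrite -ltnS -(ltn_exp2l _ _ (ltnSn 1)) (leq_ltn_trans _ kn)// trunc_logP.
  by rewrite trunc_log_max.
Qed.

(** The small factor is made smaller than the inverse of the bound of the other one; the added 1
    gives [q < 1]. If [X] is the small factor, its conditions are pulled back along [T] and [Y]. *)
Lemma factor_contracts (X T Y : bounded_op H) :
  essentially_small X \/ essentially_small Y ->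
  exists m (psi : H -> 'rV[R[i]]_m) (q : R[i]), [/\ linear psi, q < 1 &
    forall x (s : R[i]), psi x = 0 -> 0 <= s -> `|T (Y x)| <= s * `|Y x| ->
      `|X (T (Y x))| <= q * (s * `|x|)].
Proof.
have [M M0 XM] := bop_bounded_ge0 X; have [N N0 YN] := bop_bounded_ge0 Y.
have M1 : 0 < M + 1 by rewrite ltr_wpDl.
have N1 : 0 < N + 1 by rewrite ltr_wpDl.
case=> [Xs|Ys].
  have [|m [phi [philin phiX]]] := Xs (N + 1)^-1; first by rewrite invr_gt0.
  exists m, (phi \o T \o Y), ((N + 1)^-1 * N); split.
  - by move=> k x y /=; rewrite !bop_linear philin.
  - by rewrite mulrC ltr_pdivrMr// mul1r ltrDl.
  - move=> x s /phiX Xx s0 TYx; rewrite (le_trans Xx)// -mulrA.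
    rewrite ler_wpM2l ?invr_ge0 ?(ltW N1)// (le_trans TYx)// mulrCA.
    exact: ler_wpM2l.
have [|m [phi [philin phiY]]] := Ys (M + 1)^-1; first by rewrite invr_gt0.
exists m, phi, (M / (M + 1)); split=> //.
  by rewrite ltr_pdivrMr// mul1r ltrDl.
move=> x s /phiY Yx s0 TYx; rewrite (le_trans (XM _))// -mulrA.
rewrite ler_wpM2l// (le_trans TYx)// mulrCA.
exact: ler_wpM2l.
Qed.

(* On the [2 ^ k.+1]-dimensional span of the first [v i] the operator [T] is at
   least [tau k]. The at most [m + 2 ^ k] linear conditions that make [X T Y]
   strictly smaller than [tau k] have a nonzero common solution there as soon as
   [m < 2 ^ k]. *)
Lemma plateau_no_factor v (t tau : nat -> R[i]) (T X Y : bounded_op H) :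
  ON v -> is_diag t v v T -> (forall k, 0 < tau k) ->
  (forall k n, ((n < 2 ^ k.+1)%N -> tau k <= t n) /\
               ((2 ^ k <= n)%N -> 0 < t n <= tau k)) ->
  essentially_small X \/ essentially_small Y ->
  ~ (forall x, `|T x| = `|X (T (Y x))|).
Proof.
move=> vON Td tau0 tP /(factor_contracts T)[m [psi [q [psilin q1 psiP]]]] TE.
have vS := ON_subON vON.
pose phi x : 'rV[R[i]]_(m + 2 ^ m) :=
  row_mx (psi x) (\row_(i < 2 ^ m) dot (Y x) (v i)).
have philin : linear phi.
  move=> k x y; rewrite /phi scale_row_mx add_row_mx psilin; congr row_mx.
  by apply/rowP => i; rewrite !mxE bop_linear linearDl /= dotZl.
(* The block index is the number [m] of conditions in [psi], since [m < 2 ^ m]. *)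
have mN : (m + 2 ^ m < 2 ^ m.+1)%N.
  by rewrite expnS mul2n -addnn ltn_add2r ltn_expl.
have [c [i0 ci0] phi0] := exists_lincomb_kernel (v \o val) philin mN.
set x := \sum_i _ in phi0.
have ordo (i j : 'I_(2 ^ m.+1)) : i != j -> dot (v i) (v j) = 0.
  by move=> ij; rewrite vON (negPf (ij : (i : nat) != j)).
have v1 n : `|v n| ^+ 2 = 1 by rewrite dot_norm vON eqxx.
have xE : `|x| ^+ 2 = \sum_i `|c i| ^+ 2.
  rewrite norm_sum_orthogonal ?index_enum_uniq//.
  by apply: eq_bigr => i _; rewrite v1 mulr1.
have x0 : 0 < `|x|.
  rewrite normr_gt0 -normr_eq0 -sqrf_eq0 xE psumr_neq0//.
  by apply/hasP; exists i0; rewrite ?mem_index_enum// exprn_gt0 ?normr_gt0.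
have TxE : T x = \sum_(i < 2 ^ m.+1) (c i * t i) *: v i.
  rewrite (linear_lincomb _ _ (@bop_linear _ _ T)); apply: eq_bigr => i _ /=.
  by rewrite (diag_basis vS Td) v1 mulr1 scalerA.
have Tx_ge : tau m * `|x| <= `|T x|.
  rewrite -ler_sqr ?nnegrE ?mulr_ge0 ?(ltW (tau0 m))// exprMn TxE xE.
  rewrite norm_sum_orthogonal ?index_enum_uniq// mulr_sumr.
  apply: ler_sum => i _; rewrite v1 mulr1 normrM exprMn mulrC.
  rewrite ler_wpM2l ?exprn_ge0// ler_sqr ?nnegrE ?(ltW (tau0 m))//.
  have tle := (tP m i).1 (ltn_ord i).
  by rewrite ger0_norm// (le_trans _ tle)// ltW.
have /eq_row_mx[psi0 /rowP Yv0] : phi x = row_mx 0 0 by rewrite row_mx0.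
(* [Y x] is orthogonal to the first [2 ^ m] vectors, so only eigenvalues at most [tau m] act on
   it. *)
have TYx : `|T (Y x)| <= tau m * `|Y x|.
  apply: (diag_norm_le vS vS Td) => [|k Yk]; first exact: ltW.
  have /(tP m k).2/andP[t0 tle] : (2 ^ m <= k)%N.
    rewrite leqNgt; apply: contra Yk => km.
    by have := Yv0 (Ordinal km); rewrite !mxE => ->.
  by rewrite gtr0_norm.
have := le_trans Tx_ge; rewrite TE => /(_ _ (psiP _ _ psi0 (ltW (tau0 m)) TYx)).
by rewrite ler_pMl ?mulr_gt0// => /le_lt_trans /(_ q1); rewrite ltxx.
Qed.

(** * The operator iT and the failure of the SI property *)

Fact iop_linear : linear (fun x : H => 'i *: x).
Proof. by move=> k x y; rewrite scalerDr !scalerA mulrC. Qed.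

Fact iop_bounded : exists M : R[i], forall x : H, `|'i *: x| <= M * `|x|.
Proof. by exists 1 => x; rewrite normrZ normCi. Qed.

(** The scalar i enters as a ring factor, so iT lies in every ideal containing [T]. *)
Definition iop := BoundedOp iop_linear iop_bounded.

(** The conjugate of -i is i, and nondegeneracy of [dot] makes the adjoint unique, so [xget] returns
    it. *)
Lemma adjoint_iop (T : bounded_op H) :
  (forall x y, dot (T x) y = dot x (T y)) -> adjoint dot (iop * T) = - (iop * T).
Proof.
move=> Tsym; have adj x y : dot ((iop * T) x) y = dot x ((- (iop * T)) y).
  rewrite (_ : (iop * T) x = 'i *: T x)//.
  rewrite (_ : (- (iop * T)) y = - ('i *: T y))// -scaleNr dotZl dotZr Tsym.
  by rewrite rmorphN/= conjCi opprK.
apply: xget_unique => // B AB; apply: bopP => y; apply: dot_eqr => x.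
by rewrite -AB adj.
Qed.

Lemma ideal_not_SI (I : set (bounded_op H)) : separable_space H ->
  two_sided_ideal I -> I <> [set 0] -> I <> setT -> I <> @finite_rank _ H ->
  ~ SI_semigroup dot I.
Proof.
move=> Hsep Iid I0 IT IF [_ ISI].
have [A IA Afr] : exists2 A, I A & ~ finite_rank A.
  apply: contrapT => nA; apply: IF; apply/seteqP; split.
    by move=> A IA; apply: contrapT => Afr; apply: nA; exists A.
  exact: finite_rank_sub_ideal.
have [v [t [tau [T [vON Td ITT tau0 tP]]]]] := plateau_diagonal Iid IA Afr.
have [_ _ IM] := Iid.
have t0 n : 0 < t n.
  apply: lt_le_trans (tau0 n) ((tP n n).1 _).
  by rewrite (ltn_trans (ltn_expl n (ltnSn 1)))// ltn_exp2l.
have Tsym x y : dot (T x) y = dot x (T y).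
  by apply: diag_sym Td => n; rewrite gtr0_real.
pose S := iop * T.
(* One outer factor lies in [I] and the other is arbitrary, so that [1] covers one-sided
   products. *)
pose J (B : bounded_op H) :=
  B = S \/ exists X Y, (I X \/ I Y) /\ B = X * S * Y.
have IS : I S by apply: (IM _ _ _).1.
have Jid : semigroup_ideal I J.
  split=> [B [->//|[X [Y [_ ->]]]]|B X JB IX].
    by apply: (IM _ _ _).2; apply: (IM _ _ _).1.
  case: JB => [->|[X' [Y' [_ ->]]]]; split; right.
  - by exists X, 1; split; [left|rewrite mulr1].
  - by exists 1, X; split; [right|rewrite mul1r].
  - by exists (X * X'), Y'; split; [left; apply: (IM _ _ _).2|rewrite !mulrA].
  - by exists X', (Y' * X); split; [right; apply: (IM _ _ _).1|rewrite !mulrA].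
have : J (adjoint dot S) by apply: (ISI J Jid); exists S => //; left.
rewrite adjoint_iop// -/S => -[SN|[X [Y [XY SXY]]]].
  (* [- S = S] fails at [v 0], an eigenvector of [T] with positive eigenvalue. *)
  have /eqP : - ('i *: T (v 0%N)) = 'i *: T (v 0%N).
    exact: (congr1 (fun B : bounded_op H => B (v 0%N)) SN).
  rewrite eq_sym -addr_eq0 -mulr2n -scaler_nat scaler_eq0 pnatr_eq0/=.
  rewrite scaler_eq0 (negPf (neq0Ci _))/= (diag_basis (ON_subON vON) Td) scaler_eq0.
  rewrite dot_norm vON eqxx mulr1 gt_eqF//= -normr_eq0 -sqrf_eq0.
  by rewrite dot_norm vON eqxx oner_eq0.
apply: (@plateau_no_factor v t tau T X Y) => //.
  by case: XY => [IX|IY]; [left|right]; exact: (proper_ideal_small Hsep Iid IT).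
(* Taking norms removes the factors i and -1. *)
move=> x; have : `|- ('i *: T x)| = `|X ('i *: T (Y x))|.
  exact: (congr1 (fun B : bounded_op H => `|B x|) SXY).
by rewrite bopZ normrN !normrZ normCi !mul1r.
Qed.

End Hilbert.

Theorem corollary1p18 (R : realType) (H : completeNormedModType R[i])
    (dot : {dot H for Num.conj})
    (dot_norm : forall x : H, `|x| ^+ 2 = dot x x) :
  SI_semigroup dot (@finite_rank _ H) /\
  (separable_space H ->
   forall I : set (bounded_op H),
     two_sided_ideal I ->
     I <> [set 0] -> I <> setT -> I <> @finite_rank _ H ->
     ~ SI_semigroup dot I).
Proof.
split; first exact: finite_rank_SI.
by move=> Hsep I Iid I0 IT IF; exact: ideal_not_SI.
Qed.
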